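(* Let $X\subset\mathbb{Z}$ be a $2$-connected finite digital image. Then $\mathrm{TC}(X,2)=1$.
   Context: A digital image in $\mathbb{Z}$ is a finite subset $X\subset\mathbb{Z}$ with $2$-adjacency: $x\leftrightarrow y$ iff $|x-y|=1$. It is $2$-connected if any two distinct points are joined by a finite sequence of points of $X$ in which consecutive points are adjacent. In $X\times X$, two distinct points are adjacent if in each coordinate their components are equal or adjacent. A map is digitally continuous if adjacent points have adjacent or equal images. The digital interval $[0,m]_{\mathbb{Z}}=\{0,1,\dots,m\}$ carries $2$-adjacency. A digital path in $X$ is a digitally continuous map $\alpha:[0,m]_{\mathbb{Z}}\to X$, $m\ge 0$ arbitrary. $PX$ is the set of all digital paths in $X$; two paths are adjacent if, after extending the one with fewer steps by repeating its last point so both have the same number of steps, their values at each $t$ are equal or adjacent. Let $\pi:PX\to X\times X$, $\pi(\alpha)=(\alpha(0),\alpha(m))$. $\mathrm{TC}(X,2)$ is the minimal $k$ such that $X\times X=U_1\cup\dots\cup U_k$ and for each $j$ there is a digitally continuous $s_j:U_j\to PX$ with $\pi\circ s_j=\mathrm{id}_{U_j}$ ($\infty$ if no such $k$ exists). *)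

(* Defs.v *)
From mathcomp Require Import all_boot all_order all_algebra.
From mathcomp Require Import finmap.
From mathcomp Require Import boolp.

Set Implicit Arguments.
Unset Strict Implicit.
Unset Printing Implicit Defensive.

Import Order.TTheory GRing.Theory Num.Theory.
Local Open Scope ring_scope.

Definition adj2 : rel int := fun x y => `|x - y| == 1.

Definition adj_or_eq (T : eqType) (e : rel T) : rel T :=
  fun x y => (x == y) || e x y.

(* Images are compared with [=] rather than [==], so that the codomain may be
   the type of digital paths, which is not an eqType. *)
Definition digitally_continuous (A B : Type) (eA : rel A) (eB : rel B)
    (f : A -> B) : Prop :=
  forall x y : A, eA x y -> f x = f y \/ eB (f x) (f y).

Definition interval_adj (m : nat) : rel 'I_m.+1 :=
  fun s t => adj2 (s : nat)%:Z (t : nat)%:Z.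

Section DigitalImage.

Variable X : {fset int}.

Definition image_adj : rel X := fun x y => adj2 (val x) (val y).

Definition connected2 : Prop :=
  forall x y : X, x <> y ->
    exists p : seq X, path image_adj x p /\ last x p = y.

Definition square_adj : rel (X * X) := fun u v =>
  [&& u != v, adj_or_eq image_adj u.1 v.1 & adj_or_eq image_adj u.2 v.2].

Record digital_path := DigitalPath {
  steps : nat;
  path_fun :> 'I_steps.+1 -> X;
  path_continuous : digitally_continuous (@interval_adj steps) image_adj path_fun
}.

(* The value at [t] of the path prolonged by repeating its last point;
   [inord] is applied below its bound, so its default is never used. *)
Definition extended_path (a : digital_path) (t : nat) : X :=
  a (inord (minn t (steps a))).

Definition path_adj : rel digital_path := fun a b =>
  [forall t : 'I_(maxn (steps a) (steps b)).+1,
     adj_or_eq image_adj (extended_path a t) (extended_path b t)].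

Definition endpoints (a : digital_path) : X * X := (a ord0, a ord_max).

Definition has_section (U : {set X * X}) : Prop :=
  exists s : {u : X * X | u \in U} -> digital_path,
    digitally_continuous (fun u v => square_adj (sval u) (sval v)) path_adj s /\
    forall u, endpoints (s u) = sval u.

(* A cover has at least one member; this matters only for empty [X], where
   the (empty) square would otherwise be covered by zero sets. *)
Definition TC_cover (k : nat) : Prop :=
  (0 < k)%N /\
  exists U : 'I_k -> {set X * X},
    \bigcup_(j < k) U j = [set: X * X] /\ forall j : 'I_k, has_section (U j).

(* [None] stands for infinity. *)
Definition TC : option nat :=
  match pselect (exists k, `[< TC_cover k >]) with
  | left exk => Some (ex_minn exk)
  | right _ => None
  end.

End DigitalImage.

(* Main.v *)
Require Import Defs.
From mathcomp Require Import all_boot all_order all_algebra.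
From mathcomp Require Import finmap.
From mathcomp Require Import boolp zify.

(** A connected image in the integers contains every integer lying between two
    of its points ([connected2_convex]), so that any two points [x] and [y] are
    joined inside it by the path walking straight from [x] to [y] at unit speed.
    One section over the whole square therefore gives the value 1, provided
    this path depends continuously on its ends.

    After [t] steps the walk is at the median of [x - t], [y] and [x + t]: the
    point nearest to [y] among those that [t] steps can reach.  The median
    is nonexpansive for the sup norm ([median_nonexpansive]), and this yields
    both continuities at once.  With [x], [y] fixed, changing [t] by 1 moves the
    three arguments by at most 1, so the walk is a digital path; with [t] fixed,
    replacing [(x, y)] by an adjacent pair does the same, so adjacent pairs have
    adjacent walks, whether or not [x - y] changes sign between the two pairs.
    Once [y] is reached the median stays at [y], so the same formula also
    describes the walk prolonged by repeating its last point. *)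

Import Order.TTheory GRing.Theory Num.Theory.
Local Open Scope ring_scope.

(** This is the median of the three arguments only when [a <= c]. *)
Definition median (a b c : int) : int := Num.max a (Num.min b c).

Definition walk (x y : int) (t : nat) : int := median (x - t%:Z) y (x + t%:Z).

Lemma median_nonexpansive (k a b c a' b' c' : int) :
  `|a - a'| <= k -> `|b - b'| <= k -> `|c - c'| <= k ->
  `|median a b c - median a' b' c'| <= k.
Proof. rewrite /median; lia. Qed.

Lemma walk0 (x y : int) : walk x y 0 = x.
Proof. rewrite /walk /median; lia. Qed.

Lemma walk_arrived (x y : int) (t : nat) : (`|x - y| <= t)%N -> walk x y t = y.
Proof. rewrite /walk /median; lia. Qed.

Lemma walk_stationary (x y : int) (t : nat) :
  walk x y (minn t `|x - y|%N) = walk x y t.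
Proof.
by case: leqP => // lt_xy_t; rewrite !walk_arrived // ltnW.
Qed.

Lemma walk_between (x y : int) (t : nat) :
  Num.min x y <= walk x y t <= Num.max x y.
Proof. rewrite /walk /median; lia. Qed.

Section Image.

Variable X : {fset int}.

Lemma adj_or_eq_imageE (x y : X) :
  adj_or_eq (@image_adj X) x y = (`|val x - val y| <= 1).
Proof. rewrite /adj_or_eq /image_adj /adj2 -val_eqE /=; lia. Qed.

Lemma image_adj_close (x y : X) : image_adj x y -> `|val x - val y| <= 1.
Proof. by rewrite -adj_or_eq_imageE /adj_or_eq => ->; rewrite orbT. Qed.

Lemma square_adj_close (u v : X * X) : square_adj u v ->
  `|val u.1 - val v.1| <= 1 /\ `|val u.2 - val v.2| <= 1.
Proof. by case/and3P=> _; rewrite !adj_or_eq_imageE. Qed.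

(** A discrete intermediate value theorem: steps of length 1 cannot jump over
    an integer. *)
Lemma path_between (z : int) (p : seq X) (x : X) : path (@image_adj X) x p ->
  Num.min (val x) (val (last x p)) <= z <= Num.max (val x) (val (last x p)) ->
  z \in X.
Proof.
elim: p x => [|y p IHp] x.
  by rewrite [last _ _]/= minxx maxxx => _ /le_anti<-; apply: valP.
rewrite [path _ _ _]/= [last _ _]/= => /andP[/image_adj_close xy yp] z_xl.
have [->|z_neq_x] := eqVneq z (val x); first exact: valP.
apply: IHp yp _; lia.
Qed.

Lemma connected2_convex (x y : X) (z : int) : connected2 X ->
  Num.min (val x) (val y) <= z <= Num.max (val x) (val y) -> z \in X.
Proof.
move=> hX; have [<-|/eqP x_neq_y] := eqVneq x y.
  exact: (@path_between z [::] x).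
by have [p [xp <-]] := hX x y x_neq_y; apply: path_between.
Qed.

Hypothesis hX : connected2 X.

(** By convexity of the image the default value of [insubd] is never taken:
    see [walk_inE]. *)
Definition walk_in (u : X * X) (t : nat) : X :=
  insubd u.1 (walk (val u.1) (val u.2) t).

Lemma walk_inE (u : X * X) (t : nat) :
  val (walk_in u t) = walk (val u.1) (val u.2) t.
Proof.
by apply/insubdK/(connected2_convex u.1 u.2) => //; apply: walk_between.
Qed.

Lemma walk_in_continuous (u : X * X) (m : nat) :
  digitally_continuous (@interval_adj m) (@image_adj X)
    (fun t : 'I_m.+1 => walk_in u t).
Proof.
move=> s t; rewrite /interval_adj /adj2 => st.
suff /orP[/eqP|] : adj_or_eq (@image_adj X) (walk_in u s) (walk_in u t).
- by left.
- by right.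
rewrite adj_or_eq_imageE !walk_inE; apply: median_nonexpansive; lia.
Qed.

Definition walk_path (u : X * X) : digital_path X :=
  DigitalPath (@walk_in_continuous u `|val u.1 - val u.2|%N).

Lemma extended_walk_path (u : X * X) (t : nat) :
  val (extended_path (walk_path u) t) = walk (val u.1) (val u.2) t.
Proof.
rewrite /extended_path /= walk_inE inordK ?ltnS ?geq_minr //.
exact: walk_stationary.
Qed.

Lemma walk_path_adj (u v : X * X) :
  square_adj u v -> path_adj (walk_path u) (walk_path v).
Proof.
case/square_adj_close=> uv1 uv2; apply/forallP=> t.
rewrite adj_or_eq_imageE !extended_walk_path.
apply: median_nonexpansive; lia.
Qed.

Lemma endpoints_walk_path (u : X * X) : endpoints (walk_path u) = u.
Proof.
case: u => x y; congr (_, _); apply: val_inj; rewrite walk_inE /=.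
- exact: walk0.
- exact: walk_arrived.
Qed.

Lemma connected2_has_section (U : {set X * X}) : has_section U.
Proof.
exists (fun u => walk_path (sval u)); split=> [u v uv|u].
- by right; apply: walk_path_adj.
- exact: endpoints_walk_path.
Qed.

End Image.

Theorem corollary3p4 (X : {fset int}) (hX : connected2 X) : TC X = Some 1%N.
Proof.
have cover1 : TC_cover X 1.
  split=> //; exists (fun=> [set: X * X]); split=> [|_].
  - by rewrite big_ord1.
  - exact: connected2_has_section.
rewrite /TC; case: pselect => [exk|]; last by case; exists 1%N; apply/asboolP.
case: ex_minnP => k /asboolP[k_gt0 _] k_min; congr Some.
by apply/eqP; rewrite eqn_leq k_gt0 andbT; apply/k_min/asboolP.
Qed.
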